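(* There exist universal constants $\beta>0$ and $a,c>1$ such that the following holds. Let $k,n$ be positive integers, let $\operatorname{Enc}:\{0,1\}^k\to\{0,1\}^n$ be any function, and let $L\le\beta\cdot 2^k$, $\epsilon\in(\frac{a}{\sqrt n},\frac14)$ and $\delta<\frac13$. Then every $(\tfrac12-\epsilon,L,q,\delta)$-local list-decoder for $\operatorname{Enc}$ satisfies \[ q\ \ge\ \frac{1}{c\sqrt{\epsilon}\,\log k}-\log L. \]
   Context: For $x,y\in\{0,1\}^n$, $\mathrm{dist}(x,y)=|\{i\in[n]:x_i\ne y_i\}|/n$ is the relative Hamming distance. For $\operatorname{Enc}:\{0,1\}^k\to\{0,1\}^n$, $\alpha\ge 0$ and $w\in\{0,1\}^n$, let $\operatorname{List}_\alpha(w)=\{m\in\{0,1\}^k:\mathrm{dist}(\operatorname{Enc}(m),w)\le\alpha\}$. A randomized procedure $P(i,R)$ locally computes $m\in\{0,1\}^k$ with error $\delta$ if for every $i\in[k]$, $\Pr_R[P(i,R)=m_i]\ge 1-\delta$, where $R$ is a uniformly random string. An $(\alpha,L,q,\delta)$-local list-decoder for $\operatorname{Enc}$ is an oracle procedure $\operatorname{Dec}$ that, given oracle access to a word $w\in\{0,1\}^n$, makes at most $q$ (possibly adaptive) queries to $w$, and receives inputs $i\in[k]$, $j\in[L]$ and two random strings $r^{\mathrm{shared}},r$ (of arbitrary lengths), such that for every $w\in\{0,1\}^n$ and every $m\in\operatorname{List}_\alpha(w)$, with probability at least $2/3$ over a uniform choice of $r^{\mathrm{shared}}$ there exists $j\in[L]$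 such that the procedure $(i,r)\mapsto\operatorname{Dec}^w(i,j,r^{\mathrm{shared}},r)$ locally computes $m$ with error $\delta$. Logarithms are base 2. *)

(* Defs.v *)
From HB Require Import structures.
From mathcomp Require Import all_boot all_order all_algebra.
From mathcomp Require Import reals exp.

Set Implicit Arguments.
Unset Strict Implicit.
Unset Printing Implicit Defensive.

Import Order.TTheory GRing.Theory Num.Theory.
Local Open Scope ring_scope.

Notation bits n := (n.-tuple bool).

Definition log2 (R : realType) (x : R) : R := ln x / ln 2.

Definition Pr (R : realType) (T : finType) (E : pred T) : R :=
  #|[set x | E x]|%:R / #|T|%:R.

Definition hdist (R : realType) (n : nat) (x y : bits n) : R :=
  #|[set i : 'I_n | tnth x i != tnth y i]|%:R / n%:R.

Definition ListDec (R : realType) (k n : nat) (Enc : bits k -> bits n)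
    (alpha : R) (w : bits n) : {set bits k} :=
  [set m | hdist R (Enc m) w <= alpha].

Definition locally_computes (R : realType) (k l : nat)
    (P : 'I_k -> bits l -> bool) (m : bits k) (delta : R) : bool :=
  [forall i : 'I_k, 1 - delta <= Pr R (fun r => P i r == tnth m i)].

(* A deterministic adaptive algorithm with oracle access to an n-bit word:
   in [Query p t], the continuation [t b] is followed when the oracle answers
   [b] at position [p]. *)
Inductive oracle_alg (n : nat) : Type :=
| Output of bool
| Query of 'I_n & (bool -> oracle_alg n).

Fixpoint run (n : nat) (w : bits n) (t : oracle_alg n) : bool :=
  match t with
  | Output b => b
  | Query p t' => run w (t' (tnth w p))
  end.

Fixpoint num_queries (n : nat) (w : bits n) (t : oracle_alg n) : nat :=
  match t with
  | Output _ => 0%N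
  | Query p t' => (num_queries w (t' (tnth w p))).+1
  end.

(* [ls] and [lr] are the lengths of the shared and of the private random
   string. *)
Definition local_list_decoder (R : realType) (k n : nat)
    (Enc : bits k -> bits n) (alpha : R) (L q : nat) (delta : R) (ls lr : nat)
    (Dec : 'I_k -> 'I_L -> bits ls -> bits lr -> oracle_alg n) : Prop :=
  (forall (w : bits n) i j rs r, (num_queries w (Dec i j rs r) <= q)%N) /\
  (forall (w : bits n) (m : bits k), m \in ListDec Enc alpha w ->
     2 / 3 <= Pr R (fun rs : bits ls =>
       [exists j : 'I_L,
          locally_computes (fun i r => run w (Dec i j rs r)) m delta])).

(* Main.v *)
(* Add noise of bias [theta] to the encoding of a random message [m], and
   amplify the decoder by majority votes over O(log k) runs. For each [j], let
   [g_j] be the event that the [j]-th decoded message is [m]. Summed over [m],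
   the probability of [g_j] under uniform noise is exactly 1, so the expected
   number of successful [j] is at most [L / 2^k]; under noise of bias
   [3 epsilon / 2] it is at least 1/4, since the noisy word is then within
   distance [1/2 - epsilon] by Chebyshev.

   On the other hand [g_j] is a conjunction of functions that read
   [Q = O(q log k)] bits. A Razborov-style encoding bounds the [t]-th binomial
   moment of its sensitivity by [O(Q)^t]; hence, up to an error [2^-t], the mean
   sensitivity is at most [O(Q t)] times the probability of [g_j], and Russo's
   formula shows that this probability at most doubles as long as
   [Q t epsilon] is small. Taking [t = log L + O(1)] gives
   [q log k log L >= Omega(1 / epsilon)]. *)
Require Import Defs.
From mathcomp Require Import all_boot all_order all_algebra.
From mathcomp Require Import reals exp lra ring zify.
From mathcomp Require Import polyrcf.
Import Order.TTheory GRing.Theory Num.Theory.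
Set Implicit Arguments.
Unset Strict Implicit.
Unset Printing Implicit Defensive.
Local Open Scope ring_scope.

(** * Encoding the sensitive positions of a conjunction *)

Notation cube n := {ffun 'I_n -> bool}.

Definition upd n (y : cube n) (p : 'I_n) (b : bool) : cube n :=
  [ffun i => if i == p then b else y i].

Definition flip n (y : cube n) (p : 'I_n) : cube n := upd y p (~~ y p).

Definition agree_on n (A : {set 'I_n}) (y z : cube n) : Prop :=
  forall p, p \in A -> y p = z p.

Definition conj_fam n k (h : 'I_k -> cube n -> bool) (y : cube n) : bool :=
  [forall i, h i y].

Definition sens n (g : cube n -> bool) (x : cube n) : {set 'I_n} :=
  [set p | g x && ~~ g (flip x p)].

(* [V i y] is the set of positions read by [h i] on input [y]. *)
Definition reads n k (h : 'I_k -> cube n -> bool)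
    (V : 'I_k -> cube n -> {set 'I_n}) (Q : nat) : Prop :=
  (forall i y, (#|V i y| <= Q)%N) /\
  (forall i y z, agree_on (V i y) y z -> h i z = h i y /\ V i z = V i y).

(** This certificate can be recomputed from [y] alone. The encoding therefore never names the
    refuted function, and the bounds below do not depend on [k]. *)
Definition first_refuted n k (h : 'I_k -> cube n -> bool)
    (V : 'I_k -> cube n -> {set 'I_n}) (y : cube n) : {set 'I_n} :=
  if [pick i | ~~ h i y && [forall j : 'I_k, (j < i)%N ==> h j y]] is Some i
  then V i y else set0.

(* A symbol [(a, b, e)] says: the [a]-th element of the current certificate
   is a sensitive position, its value is [b], and [e] tells whether to move on
   to the next certificate. *)
Fixpoint decode n (p0 : 'I_n) (fV : cube n -> {set 'I_n}) Q
    (s : seq ('I_Q * bool * bool)) (y : cube n) (C : {set 'I_n}) :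
    cube n * {set 'I_n} :=
  if s is (a, b, e) :: s' then
    let p := nth p0 (enum C) a in
    let y' := upd y p b in
    let xS := decode p0 fV s' y' (if e then fV y' else C) in
    (xS.1, p |: xS.2)
  else (y, set0).

Lemma first_refutedE n k (h : 'I_k -> cube n -> bool)
    (V : 'I_k -> cube n -> {set 'I_n}) (y : cube n) (i : 'I_k) :
  ~~ h i y -> (forall j : 'I_k, (j < i)%N -> h j y) ->
  first_refuted h V y = V i y.
Proof.
move=> hi hlt; rewrite /first_refuted; case: pickP => [i'|/(_ i)]; last first.
  by rewrite hi /= => /forallP[] j; apply/implyP => /hlt.
case/andP => hi' /forallP hlt'.
suff -> : i' = i by [].
apply/val_inj/eqP; rewrite eqn_leq; apply/andP; split; rewrite leqNgt.
  by apply: contra hi => lt; have := hlt' i; rewrite lt.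
by apply: contra hi' => /hlt.
Qed.

(** The positions of [A] are restored one by one to their values in [x], all looked up in the same
    [C]. The last restoration produces [y0], and its symbol carries the flag that starts the next
    certificate [fV y0]; hence [A] must be nonempty. *)
Lemma decode_block n (p0 : 'I_n) (fV : cube n -> {set 'I_n}) Q
    (C S0 : {set 'I_n}) (x y0 : cube n) (s0 : seq ('I_Q * bool * bool)) :
  (#|C| <= Q)%N -> decode p0 fV s0 y0 (fV y0) = (x, S0) ->
  forall (A : seq 'I_n) (y : cube n), A != [::] ->
    {subset A <= C} -> (forall p, p \in A -> y0 p = x p) ->
    (forall p, p \notin A -> y p = y0 p) ->
  exists s : seq ('I_Q * bool * bool), size s = (size A + size s0)%N /\
    decode p0 fV s y C = (x, [set p in A] :|: S0).
Proof.
move=> leCQ dec0; elim=> [//|p A IH] y _ AC y0x yy0.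
have pC : p \in C by apply: AC; rewrite inE eqxx.
have lt : (index p (enum C) < Q)%N.
  apply: leq_trans leCQ; rewrite cardE index_mem mem_enum //.
have nthp : nth p0 (enum C) (index p (enum C)) = p by rewrite nth_index ?mem_enum.
have [A0|An] := eqVneq A [::].
  exists ((Ordinal lt, x p, true) :: s0); split=> /=; first by rewrite A0.
  rewrite nthp; have -> : upd y p (x p) = y0.
    apply/ffunP => i; rewrite ffunE; case: eqP => [->|ne].
      by rewrite y0x // inE eqxx.
    by rewrite yy0 // A0 inE; apply/eqP.
  rewrite dec0 /= A0; congr (_, _); apply/setP=> i.
  by rewrite !inE.
have [||i niA|s [sz dec]] := IH (upd y p (x p)) An.
- by move=> i iA; apply: AC; rewrite inE iA orbT.
- by move=> i iA; apply: y0x; rewrite inE iA orbT.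
- rewrite ffunE; case: eqP => [->|/eqP ne]; first by rewrite y0x // inE eqxx.
  by rewrite yy0 // inE negb_or ne.
exists ((Ordinal lt, x p, false) :: s); split=> /=; first by rewrite sz.
rewrite nthp dec /=; congr (_, _); apply/setP=> i.
by rewrite !inE orbA.
Qed.

(* Razborov's argument: free the positions of [S], take the first function of
   the family that is not forced to hold, refute it, and record which freed
   positions its certificate uses; then restore those positions and repeat. *)
Lemma encode_sensitive n (p0 : 'I_n) k (h : 'I_k -> cube n -> bool)
    (V : 'I_k -> cube n -> {set 'I_n}) Q (x : cube n) (S : {set 'I_n}) :
  reads h V Q -> S \subset sens (conj_fam h) x ->
  exists (y : cube n) (s : seq ('I_Q * bool * bool)),
    [/\ size s = #|S|, agree_on (~: S) y x &
        decode p0 (first_refuted h V) s y (first_refuted h V y) = (x, S)].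
Proof.
move=> [VQ Vloc]; have [N] := ubnP #|S|; elim: N S => // N IH S ltS Ssens.
have [->|/set0Pn[q qS]] := eqVneq S set0.
  by exists x, [::]; split=> //=; rewrite cards0.
have /[!inE]/andP[gx ngx] := subsetP Ssens _ qS.
pose free (z : cube n) := [forall p, (p \notin S) ==> (z p == x p)].
have freeP z : reflect (agree_on (~: S) z x) (free z).
  apply: (iffP forallP) => H p; first by rewrite inE => pS; have := H p; rewrite pS => /eqP.
  by apply/implyP => pS; rewrite H ?inE.
pose bad i := [exists z, free z && ~~ h i z].
(* Flipping a sensitive position of [S] falsifies the conjunction, so some function is not forced to
   hold. *)
have [i0 bi0] : exists i, bad i.
  move: ngx; rewrite negb_forall => /existsP[i hi]; exists i.
  apply/existsP; exists (flip x q); rewrite hi andbT; apply/freeP => p.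
  by rewrite inE ffunE; case: eqP => // ->; rewrite qS.
have [i bi imin] := @arg_minnP _ i0 bad (@nat_of_ord k) bi0.
have [z /andP[/freeP zx hiz]] := existsP bi.
have hlt (j : 'I_k) : (j < i)%N -> forall y, agree_on (~: S) y x -> h j y.
  move=> ltj y yx; apply/negPn/negP => hj.
  have := imin j; rewrite leqNgt ltj => H; apply: notF; apply: H.
  by apply/existsP; exists y; rewrite hj andbT; apply/freeP.
pose A := S :&: V i z.
(* If the certificate avoided [S], then [h i] would agree at [x] and [z], although it holds at [x]
   and fails at [z]. *)
have An : enum A != [::].
  apply/eqP => /eqP; rewrite -size_eq0 -cardE cards_eq0 => /eqP A0.
  have [e _] : h i x = h i z /\ V i x = V i z.
    apply: Vloc => p pV; apply: zx; rewrite inE; apply/negP => pS.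
    by have := in_set0 p; rewrite -A0 inE pS pV.
  by move: hiz; rewrite -e (forallP gx).
have ltSA : (#|S :\: A| < N)%N.
  have SA : S :&: A = A by apply/setIidPr; rewrite subsetIl.
  have := cardsID A S; rewrite SA.
  by move: An ltS; rewrite -size_eq0 -cardE; lia.
have [y0 [s0 [sz0 y0x dec0]]] := IH _ ltSA (subset_trans (subsetDl _ _) Ssens).
(* On [V i z] this word agrees with [z]: through [A] inside [S], and through [x] outside. So it
   refutes [h i], while every earlier function is still forced to hold. *)
pose y : cube n := [ffun p => if p \in A then z p else y0 p].
have yx : agree_on (~: S) y x.
  move=> p; rewrite inE ffunE => pS; rewrite !inE (negbTE pS) /=.
  by apply: y0x; rewrite !inE (negbTE pS) andbF.
have [hy Vy] : h i y = h i z /\ V i y = V i z.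
  apply: Vloc => p pV; rewrite ffunE !inE pV andbT.
  case: ifP => // pS; rewrite zx ?inE ?pS // y0x // !inE pS andbF //.
have [||p|s [sz dec]] := decode_block (VQ i z) dec0 (y := y) An.
- by move=> p; rewrite mem_enum inE => /andP[].
- by move=> p; rewrite mem_enum => pA; apply: y0x; rewrite !inE in pA *; case/andP: pA => -> ->.
- by rewrite mem_enum ffunE => /negbTE ->.
exists y, s; split=> //.
  by rewrite sz sz0 -cardE -(cardsID A S) (setIidPr _) // subsetIl.
have -> : first_refuted h V y = V i z.
  by rewrite -Vy; apply: first_refutedE => [|j ltj]; [rewrite hy | apply: hlt].
rewrite dec; congr (_, _); apply/setP => p; rewrite !inE mem_enum !inE.
by case: (p \in S); case: (p \in V i z).
Qed.

(** * Biased noise and moments of the sensitivity *)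

Definition bias (R : realType) (theta : R) (b : bool) : R :=
  if b then 1 / 2 - theta else 1 / 2 + theta.

(** The noise vector has [true] at the corrupted positions, each independently with probability
    [1/2 - theta]; [theta = 0] is uniform noise. *)
Definition mu (R : realType) n (theta : R) (z : cube n) : R :=
  \prod_i bias theta (z i).

Definition muPr (R : realType) n (theta : R) (g : cube n -> bool) : R :=
  \sum_z mu theta z * (g z)%:R.

Lemma bias_ge0 (R : realType) (theta : R) b :
  0 <= theta <= 1 / 2 -> 0 <= bias theta b.
Proof. by move=> /andP[t0 t1]; rewrite /bias; case: b; lra. Qed.

Lemma mu_ge0 (R : realType) n (theta : R) (z : cube n) :
  0 <= theta <= 1 / 2 -> 0 <= mu theta z.
Proof. by move=> ht; apply: prodr_ge0 => i _; apply: bias_ge0. Qed.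

Lemma expect_prod (R : realType) n (theta : R) (f : 'I_n -> bool -> R) :
  \sum_(z : cube n) mu theta z * \prod_i f i (z i) =
  \prod_i ((1 / 2 - theta) * f i true + (1 / 2 + theta) * f i false).
Proof.
rewrite (eq_bigr (fun z : cube n => \prod_i (bias theta (z i) * f i (z i))));
  last by move=> z _; rewrite big_split.
rewrite -(bigA_distr_bigA (fun i b => bias theta b * f i b)) /=.
by apply: eq_bigr => i _; rewrite big_bool.
Qed.

Lemma sum_mu (R : realType) n (theta : R) : \sum_(z : cube n) mu theta z = 1.
Proof.
have := expect_prod theta (fun (_ : 'I_n) _ => 1).
rewrite [RHS]big1; last by move=> i _; lra.
by move=> <-; apply: eq_bigr => z _; rewrite big1 ?mulr1.
Qed.

Lemma mu0 (R : realType) n (z : cube n) : mu 0 z = (1 / 2 : R) ^+ n.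
Proof.
rewrite /mu (eq_bigr (fun=> 1 / 2)) ?prodr_const ?card_ord // => i _.
by rewrite /bias subr0 addr0 if_same.
Qed.

(** The factor 7 is the largest ratio of the two bit probabilities, [(1/2 + 3/8) / (1/2 - 3/8)]. *)
Lemma mu_agree (R : realType) n (theta : R) (S : {set 'I_n}) (x y : cube n) :
  0 <= theta <= 3 / 8 -> agree_on (~: S) y x ->
  mu theta x <= 7 ^+ #|S| * mu theta y.
Proof.
move=> /andP[t0 t1] yx.
rewrite -prodr_const big_mkcond -big_split /=; apply: ler_prod => i _.
rewrite bias_ge0 /=; last by apply/andP; split; lra.
case: ifP => iS; last by rewrite mul1r yx // inE iS.
by rewrite /bias; case: (x i); case: (y i); lra.
Qed.

(** The binomial counts the sets [S] of [t] sensitive positions of [x]. Each pair [(x, S)] is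
    decoded from some [(y, s)] at a cost of [7 ^ t] in weight, there are [(4 Q) ^ t] strings [s],
    and the weights of all [y] sum to 1. *)
Lemma sens_moment (R : realType) n k (h : 'I_k -> cube n -> bool)
    (V : 'I_k -> cube n -> {set 'I_n}) Q t (theta : R) :
  reads h V Q -> 0 <= theta <= 3 / 8 ->
  \sum_x mu theta x * 'C(#|sens (conj_fam h) x|, t)%:R <= (28 * Q%:R) ^+ t.
Proof.
move=> hV ht; have /andP[t0 t1] := ht.
have ht2 : 0 <= theta <= 1 / 2 by apply/andP; split; lra.
(* Decoding needs a default position, so [n = 0] is treated apart. *)
have [n0|n_gt0] := posnP n.
  have s0 x : #|sens (conj_fam h) x| = 0%N.
    by apply/eqP; rewrite -leqn0 -n0 -[X in (_ <= X)%N]card_ord max_card.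
  under eq_bigr do rewrite s0.
  case: t => [|t]; first by rewrite expr0 bin0 -mulr_suml sum_mu mulr1.
  rewrite bin0n mulr0n -mulr_suml mulr0 exprn_ge0 // mulr_ge0 //.
pose p0 := Ordinal n_gt0.
set g := conj_fam h.
pose fV := first_refuted h V.
pose dec (e : cube n * t.-tuple ('I_Q * bool * bool)) :=
  decode p0 fV e.2 e.1 (fV e.1).
pose valid (xS : cube n * {set 'I_n}) := (xS.2 \subset sens g xS.1) && (#|xS.2| == t).
have -> : \sum_x mu theta x * 'C(#|sens g x|, t)%:R =
    \sum_(xS | valid xS) mu theta xS.1.
  rewrite -(pair_big_dep xpredT (fun x S => valid (x, S)) (fun x S => mu theta x)) /=.
  apply: eq_bigr => x _; rewrite sumr_const -cards_draws mulr_natr.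
  by congr (_ *+ _); apply: eq_card => S; rewrite !inE.
have step (xS : cube n * {set 'I_n}) : valid xS ->
    mu theta xS.1 <= \sum_(e | dec e == xS) 7 ^+ t * mu theta e.1.
  case: xS => x S /andP[/= Ss /eqP St].
  have [y [s [ssz yx de]]] := encode_sensitive p0 hV Ss.
  have sz : size s == t by rewrite ssz St.
  rewrite (bigD1 (y, Tuple sz)) /=; last by apply/eqP; exact: de.
  apply: ler_wpDr; last by rewrite -St mu_agree.
  by apply: sumr_ge0 => e _; rewrite mulr_ge0 ?exprn_ge0 ?mu_ge0.
apply: le_trans (ler_sum _ step) _.
apply: (@le_trans _ _ (\sum_(e : cube n * t.-tuple ('I_Q * bool * bool)) 7 ^+ t * mu theta e.1)).
  rewrite [leRHS](partition_big dec xpredT) //=.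
  rewrite [leRHS](bigID valid) /= ler_wpDr //.
  apply: sumr_ge0 => xS _; apply: sumr_ge0 => e _.
  by rewrite mulr_ge0 ?exprn_ge0 ?mu_ge0.
rewrite -(pair_bigA _ (fun (y : cube n) (_ : t.-tuple ('I_Q * bool * bool)) =>
  7 ^+ t * mu theta y)) /=.
under eq_bigr do rewrite sumr_const.
rewrite sumrMnl -mulr_sumr sum_mu mulr1.
set N := #|_|; have -> : N = ((Q * 2 * 2) ^ t)%N.
  by rewrite -[Q in RHS]card_ord -card_bool -!card_prod -card_tuple; apply: eq_card.
rewrite -[leLHS]mulr_natr natrX -exprMn le_eqVlt; apply/orP; left; apply/eqP.
by congr (_ ^+ _); rewrite !natrM; lra.
Qed.

(** The induction combines [(s + 1) C(s, t) = (t + 1) C(s + 1, t + 1)] with [(s + 1) t <= s (t + 1)]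
    raised to the power [t]. *)
Lemma exp_le_bin s t : (t <= s)%N -> (s ^ t <= t ^ t * 'C(s, t))%N.
Proof.
elim: t s => [|t IH] [|s] // ts; rewrite ?bin0 //.
have {IH} := IH s ts => IH.
have [t0|t_gt0] := posnP t; first by rewrite t0 !expn1 bin1 mul1n.
have h : (s.+1 ^ t * t ^ t <= s ^ t * t.+1 ^ t)%N.
  by rewrite -!expnMn leq_exp2r //; move: ts; nia.
have tt : (0 < t ^ t)%N by rewrite expn_gt0 t_gt0.
have d := mul_bin_diag s.+1 t; rewrite /= in d.
rewrite -(leq_pmul2l tt) !expnS.
apply: (@leq_trans (s.+1 * (s ^ t * t.+1 ^ t))); first by move: h; nia.
rewrite [leqRHS](_ : _ = t ^ t * t.+1 ^ t * (t.+1 * 'C(s.+1, t.+1)))%N; last by ring.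
rewrite -d; apply: (@leq_trans (s.+1 * (t ^ t * 'C(s, t) * t.+1 ^ t))).
  by rewrite leq_mul2l leq_mul2r IH !orbT.
by apply: eq_leq; ring.
Qed.

(** Truncation at [u = 56 Q t]. A sensitivity [s] above [u] satisfies
    [s u^(t-1) <= s^t <= t^t C(s, t)], so the moment bound controls it. The threshold uses twice the
    constant 28 of that bound, whence the error [(1/2)^t]. *)
Lemma sens_mean (R : realType) n k (h : 'I_k -> cube n -> bool)
    (V : 'I_k -> cube n -> {set 'I_n}) Q t (theta : R) :
  reads h V Q -> (0 < t)%N -> 0 <= theta <= 3 / 8 ->
  \sum_x mu theta x * #|sens (conj_fam h) x|%:R <=
  56 * Q%:R * t%:R * (muPr theta (conj_fam h) + (1 / 2) ^+ t).
Proof.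
move=> hV t_gt0 ht; have /andP[t0 t1] := ht.
have ht2 : 0 <= theta <= 1 / 2 by apply/andP; split; lra.
set g := conj_fam h.
have [Q0|Q_gt0] := posnP Q.
  have := sens_moment 1 hV ht; rewrite Q0 mulr0 expr1 !(mul0r, mulr0).
  by under eq_bigr do rewrite bin1.
set u : R := 56 * Q%:R * t%:R.
have Q1 : 1 <= Q%:R :> R by rewrite ler1n.
have T1 : 1 <= t%:R :> R by rewrite ler1n.
have u_ge : t%:R <= u by rewrite /u ler_peMl //; lra.
have cQ : 0 < (56 * Q%:R) ^+ t :> R by rewrite exprn_gt0 //; lra.
have u0 : 0 <= u by lra.
have cQ0 := ltW cQ.
have pt x : #|sens g x|%:R <=
    u * ((g x)%:R + 'C(#|sens g x|, t)%:R / (56 * Q%:R) ^+ t).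
  have [gx|gx] := boolP (g x); last first.
    have -> : sens g x = set0.
      by apply/setP => p; rewrite !inE (negbTE gx).
    by rewrite cards0 mulr_ge0 ?addr_ge0 ?divr_ge0.
  set s := #|_|; have [le|lt] := lerP (s%:R : R) u.
    by rewrite (le_trans le) // ler_peMr ?lerDl ?divr_ge0.
  have ts : (t <= s)%N by rewrite -(ler_nat R); lra.
  have := exp_le_bin ts; rewrite -(ler_nat R) natrM !natrX => B.
  rewrite mulrDr; apply: ler_wpDl; first by rewrite mulr_ge0 //; lra.
  rewrite mulrA ler_pdivlMr //.
  have up : 0 < u ^+ t.-1 by rewrite exprn_gt0 //; lra.
  have Tp : 0 < t%:R ^+ t :> R by rewrite exprn_gt0 //; lra.
  have e : (56 * Q%:R) ^+ t * t%:R ^+ t = u * u ^+ t.-1 :> R.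
    by rewrite -exprMn -exprS prednK.
  rewrite -(ler_pM2r Tp) -[leLHS]mulrA e -[leRHS]mulrA mulrCA ler_wpM2l // mulrC (mulrC _ (_ ^+ t)).
  apply: le_trans B; rewrite -[X in _ <= _ ^+ X](prednK t_gt0) exprSr.
  rewrite ler_wpM2r //; apply: lerXn2r; rewrite ?nnegrE //; lra.
apply: (@le_trans _ _ (\sum_x u * (mu theta x * (g x)%:R +
     mu theta x * 'C(#|sens g x|, t)%:R / (56 * Q%:R) ^+ t))).
  apply: ler_sum => x _.
  apply: le_trans (ler_wpM2l (mu_ge0 x ht2) (pt x)) _.
  by rewrite le_eqVlt mulrCA mulrDr mulrA eqxx.
rewrite -mulr_sumr ler_wpM2l ?(le_trans _ u_ge) //.
rewrite big_split /= lerD2l -mulr_suml ler_pdivrMr //.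
apply: le_trans (sens_moment t hV ht) _.
rewrite -exprMn le_eqVlt; apply/orP; left; apply/eqP; congr (_ ^+ _); lra.
Qed.

(** * Russo's formula and the coin problem *)

Lemma deriv_prod_seq (R : comNzRingType) (I : eqType) (r : seq I)
    (P : I -> {poly R}) : uniq r ->
  (\prod_(i <- r) P i)^`() =
  \sum_(i <- r) (P i)^`() * \prod_(j <- r | j != i) P j.
Proof.
elim: r => [|a r IH] /=; first by rewrite !big_nil derivC.
case/andP => ar ur; rewrite !big_cons derivM IH // eqxx /=.
congr (_ + _).
  congr (_ * _); rewrite [RHS]big_seq_cond [LHS]big_seq; apply: eq_bigl => i.
  by case: (boolP (i \in r)) => //= ir; symmetry; apply/eqP => e; rewrite -e ir in ar.
rewrite mulr_sumr [LHS]big_seq [RHS]big_seq; apply: eq_bigr => i ir.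
rewrite big_cons ifT; last by apply/eqP => e; rewrite e ir in ar.
by rewrite mulrCA.
Qed.

(** The probability as a polynomial in [theta]: its derivative is formal, and the mean value theorem
    for polynomials applies. *)
Definition muPr_poly (R : realType) n (g : cube n -> bool) : {poly R} :=
  \sum_z (g z)%:R *: \prod_i ((1 / 2)%:P + (if z i then -1 else 1) *: 'X).

Lemma muPr_polyE (R : realType) n (g : cube n -> bool) (theta : R) :
  (muPr_poly R g).[theta] = muPr theta g.
Proof.
rewrite /muPr_poly horner_sum; apply: eq_bigr => z _.
rewrite hornerZ horner_prod mulrC; congr (_ * _); apply: eq_bigr => i _.
by rewrite hornerD hornerC hornerZ hornerX /bias; case: (z i); lra.
Qed.

Lemma flipK n (p : 'I_n) : involutive (fun z : cube n => flip z p).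
Proof.
move=> z; apply/ffunP => i; rewrite !ffunE; case: eqP => // ->.
by rewrite eqxx negbK.
Qed.

(* Russo's formula. The edges inside [g] cancel in pairs. *)
Lemma muPr_deriv_le (R : realType) n (g : cube n -> bool) (theta : R) :
  0 <= theta <= 1 / 2 ->
  (muPr_poly R g)^`().[theta] <= 2 * \sum_x mu theta x * #|sens g x|%:R.
Proof.
move=> ht; have /andP[t0 t1] := ht.
pose M i (z : cube n) := \prod_(j | j != i) bias theta (z j).
have M0 i z : 0 <= M i z by apply: prodr_ge0 => j _; apply: bias_ge0.
have muM i z : mu theta z = bias theta (z i) * M i z by rewrite /mu (bigD1 i).
pose c (b : bool) : R := if b then -1 else 1.
have -> : (muPr_poly R g)^`().[theta] =
    \sum_i \sum_z (g z)%:R * (c (z i) * M i z).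
  rewrite exchange_big /= /muPr_poly raddf_sum horner_sum; apply: eq_bigr => z _.
  rewrite /= derivZ hornerZ deriv_prod_seq ?index_enum_uniq //.
  rewrite horner_sum mulr_sumr; apply: eq_bigr => i _; congr (_ * _).
  rewrite hornerM horner_prod derivD derivC add0r derivZ derivX hornerZ hornerC mulr1.
  congr (_ * _); apply: eq_bigr => j _.
  by rewrite hornerD hornerC hornerZ hornerX /bias; case: (z j); lra.
have -> : \sum_x mu theta x * #|sens g x|%:R =
    \sum_i \sum_z mu theta z * (i \in sens g z)%:R.
  rewrite exchange_big /=; apply: eq_bigr => z _.
  by rewrite -mulr_sumr -sum1_card natr_sum big_mkcond; congr (_ * _);
     apply: eq_bigr => i _; case: (i \in _).
rewrite mulr_sumr; apply: ler_sum => i _.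
(* The second term is symmetric under flipping [i], which changes the sign of [c (z i)], so its sum
   is its own opposite. *)
have split z : (g z)%:R = (i \in sens g z)%:R + (g z && g (flip z i))%:R :> R.
  by rewrite inE; case: (g z); case: (g _); rewrite /= ?addr0 ?add0r.
under eq_bigr do rewrite split mulrDl.
rewrite big_split /= [X in _ + X](_ : _ = 0) ?addr0; last first.
  set E := \sum_z _; suff : E = - E by lra.
  rewrite {1}/E (reindex_inj (inv_inj (@flipK n i))) /= -sumrN.
  apply: eq_bigr => z _; rewrite flipK andbC -mulrN; congr (_ * _).
  have -> : M i (flip z i) = M i z.
    by apply: eq_bigr => j ji; rewrite ffunE (negbTE ji).
  by rewrite ffunE eqxx -mulNr; congr (_ * _); rewrite /c; case: (z i); rewrite ?opprK.
rewrite mulr_sumr; apply: ler_sum => z _.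
(* Only [z i = false] contributes positively; there the bias is at least 1/2, which accounts for the
   factor 2. *)
rewrite (muM i); case: (i \in sens g z); last by rewrite mul0r !mulr0.
rewrite mul1r mulr1 mulrA ler_wpM2r // /c /bias; case: (z i); lra.
Qed.

(** Russo's formula and the mean sensitivity give [F' <= K F] for [F = muPr + (1/2)^t] and
    [K = 112 Q t]. Hence [F] at most doubles while [K theta <= 1/2]. *)
Lemma coin_problem (R : realType) n k (h : 'I_k -> cube n -> bool)
    (V : 'I_k -> cube n -> {set 'I_n}) Q t (theta : R) :
  reads h V Q -> (0 < t)%N -> 0 < theta <= 3 / 8 ->
  112 * Q%:R * t%:R * theta <= 1 / 2 ->
  muPr theta (conj_fam h) <= 2 * muPr 0 (conj_fam h) + (1 / 2) ^+ t.
Proof.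
move=> hV t_gt0 /andP[th0 th1]; set K : R := 112 * _ * _ => Kth.
have K0 : 0 <= K by rewrite !mulr_ge0.
set g := conj_fam h; set tau : R := (1 / 2) ^+ t.
have tau0 : 0 <= tau by rewrite exprn_ge0 //; lra.
(* If F' <= K F, then (1 - K x) F is nonincreasing as long as K x <= 1. *)
pose p := (1 - K *: 'X) * (muPr_poly R g + tau%:P).
have [x] := poly_mvt p th0.
rewrite in_itv /= => /andP[x0 xth] E.
have hx : 0 <= x <= 3 / 8 by apply/andP; split; lra.
have hx2 : 0 <= x <= 1 / 2 by apply/andP; split; lra.
have Kx : K * x <= 1 / 2 by apply: le_trans Kth; rewrite ler_wpM2l // ltW.
have F0 : 0 <= muPr x g + tau.
  by rewrite addr_ge0 //; apply: sumr_ge0 => z _; rewrite mulr_ge0 ?mu_ge0.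
have D : (muPr_poly R g)^`().[x] <= K * (muPr x g + tau).
  apply: le_trans (muPr_deriv_le g hx2) _.
  have := sens_mean hV t_gt0 hx; rewrite -/g -/tau.
  by rewrite /K (_ : 112 * Q%:R * t%:R = 2 * (56 * Q%:R * t%:R)); [lra | ring].
have : p^`().[x] <= 0.
  rewrite derivM derivB derivD !derivC derivZ derivX addr0 sub0r.
  rewrite !(hornerE, muPr_polyE) /=.
  have : (1 - K * x) * (muPr_poly R g)^`().[x] <= (1 - K * x) * (K * (muPr x g + tau)).
    by rewrite ler_wpM2l //; lra.
  have : 0 <= K * x * (K * (muPr x g + tau)).
    by rewrite !mulr_ge0 // ltW.
  lra.
move=> p'; have : p.[theta] <= p.[0].
  by rewrite -subr_le0 E subr0 mulr_le0_ge0 // ltW.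
rewrite /p !hornerE !muPr_polyE /= => le.
have F1 : 0 <= muPr theta g + tau.
  rewrite addr_ge0 //; apply: sumr_ge0 => z _.
  by rewrite mulr_ge0 ?mu_ge0 //; apply/andP; split; lra.
have : 1 / 2 * (muPr theta g + tau) <= (1 - K * theta) * (muPr theta g + tau).
  by rewrite ler_wpM2r //; lra.
lra.
Qed.

(** * Concentration of the noise weight *)

Lemma mu_chebyshev (R : realType) n (theta d : R) :
  0 <= theta <= 1 / 2 -> 0 < d -> (0 < n)%N ->
  muPr theta (fun z : cube n =>
    (1 / 2 - theta + d) * n%:R < #|[set i | z i]|%:R) <= (4 * d ^+ 2 * n%:R)^-1.
Proof.
move=> ht d0 n0; have /andP[t0 t1] := ht.
have n0R : 0 < n%:R :> R by rewrite ltr0n.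
pose xi (b : bool) : R := b%:R - (1 / 2 - theta).
have sumxi (z : cube n) : \sum_i xi (z i) = #|[set i | z i]|%:R - (1 / 2 - theta) * n%:R.
  rewrite big_split /= sumr_const card_ord mulNrn mulr_natr; congr (_ + _).
  rewrite -sum1_card natr_sum [RHS]big_mkcond; apply: eq_bigr => i _.
  by rewrite inE; case: (z i).
have Exy i j : \sum_(z : cube n) mu theta z * (xi (z i) * xi (z j)) <= (i == j)%:R / 4.
  (* Writing [xi (z i) * xi (z j)] as a product over all coordinates lets [expect_prod] compute the
     covariance, which vanishes off the diagonal. *)
  pose f l b := (if l == i then xi b else 1) * (if l == j then xi b else 1).
  have -> : \sum_(z : cube n) mu theta z * (xi (z i) * xi (z j)) =
      \sum_(z : cube n) mu theta z * \prod_l f l (z l).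
    apply: eq_bigr => z _; rewrite big_split /= -!big_mkcond /=.
    by rewrite !big_pred1_eq.
  rewrite expect_prod (bigD1 i) //= /f eqxx; case: (eqVneq i j) => [->|ij].
    rewrite big1 ?mulr1; last by move=> l /negbTE ->; lra.
    have := sqr_ge0 theta; rewrite /xi /=; nra.
  rewrite !mulr1 (_ : _ * xi true + _ = 0) ?mul0r //.
  by rewrite /xi /=; field.
have var : \sum_(z : cube n) mu theta z * (\sum_i xi (z i)) ^+ 2 <= n%:R / 4.
  apply: (@le_trans _ _ (\sum_(i < n) \sum_(j < n) (i == j)%:R / 4)).
    have -> : \sum_(z : cube n) mu theta z * (\sum_i xi (z i)) ^+ 2 =
      \sum_(i < n) \sum_(j < n) \sum_(z : cube n) mu theta z * (xi (z i) * xi (z j)).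
      under [RHS]eq_bigr do rewrite exchange_big.
      rewrite exchange_big /=; apply: eq_bigr => z _.
      rewrite expr2 mulr_suml mulr_sumr; apply: eq_bigr => i _.
      by rewrite !mulr_sumr.
    by apply: ler_sum => i _; apply: ler_sum => j _.
  rewrite le_eqVlt; apply/orP; left; apply/eqP.
  rewrite (eq_bigr (fun=> 1 / 4)) ?sumr_const ?card_ord; last first.
    move=> i _; rewrite (bigD1 i) //= eqxx big1 ?addr0 // => j.
    by rewrite eq_sym => /negbTE ->; rewrite mul0r.
  by rewrite div1r mulr_natl.
have dn : 0 < (d * n%:R) ^+ 2 by rewrite exprn_gt0 // mulr_gt0.
rewrite [leRHS](_ : _ = (n%:R / 4) / (d * n%:R) ^+ 2); last first.
  by field; rewrite !lt0r_neq0.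
rewrite ler_pdivlMr //; apply: le_trans var.
rewrite mulr_suml; apply: ler_sum => z _; rewrite -mulrA ler_wpM2l ?mu_ge0 //.
case: ltrP => [lt|_]; last by rewrite mul0r sqr_ge0.
rewrite mul1r sumxi; apply: lerXn2r; rewrite ?nnegrE; last 1 first.
- by move: lt; rewrite mulrDl; lra.
- by rewrite mulr_ge0 ?ltW.
- by move: lt (mulr_gt0 d0 n0R); rewrite mulrDl; lra.
Qed.

(** * Majority votes as functions of few positions *)

Fixpoint queried n (w : bits n) (t : oracle_alg n) : {set 'I_n} :=
  match t with
  | Output _ => set0
  | Query p t' => p |: queried w (t' (tnth w p))
  end.

Lemma card_queried n (w : bits n) (t : oracle_alg n) :
  (#|queried w t| <= num_queries w t)%N.
Proof.
elim: t => [b|p t' IH] /=; first by rewrite cards0.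
by rewrite cardsU1 -add1n leq_add // leq_b1.
Qed.

Lemma queried_local n (w w' : bits n) (t : oracle_alg n) :
  (forall p, p \in queried w t -> tnth w p = tnth w' p) ->
  run w' t = run w t /\ queried w' t = queried w t.
Proof.
elim: t => [b|p t' IH] //= eqw.
rewrite -(eqw p) ?setU11 //.
have [p' p'q|-> ->] // := IH (tnth w p).
by apply: eqw; rewrite setU1r.
Qed.

Definition masked n (c : bits n) (z : cube n) : bits n :=
  [tuple tnth c i (+) z i | i < n].

(** The random strings of the [2T] runs are fixed in [r], so the vote is a deterministic function of
    [w]. A tie yields [false]. *)
Definition maj n T (X : Type) (f : X -> oracle_alg n) (r : 'I_(2 * T) -> X)
    (w : bits n) : bool :=
  (T < #|[set l | run w (f (r l))]|)%N.

Definition maj_correct n k T (X : Type) (c : bits n) (m : bits k)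
    (D : 'I_k -> X -> oracle_alg n) (r : 'I_(2 * T) -> X)
    (i : 'I_k) (z : cube n) : bool :=
  maj (D i) r (masked c z) == tnth m i.

Definition maj_reads n k T (X : Type) (c : bits n)
    (D : 'I_k -> X -> oracle_alg n) (r : 'I_(2 * T) -> X)
    (i : 'I_k) (z : cube n) : {set 'I_n} :=
  \bigcup_l queried (masked c z) (D i (r l)).

Lemma maj_correct_reads n k T (X : Type) (c : bits n) (m : bits k)
    (D : 'I_k -> X -> oracle_alg n) (r : 'I_(2 * T) -> X) q :
  (forall w i x, (num_queries w (D i x) <= q)%N) ->
  reads (maj_correct c m D r) (maj_reads c D r) (2 * T * q).
Proof.
move=> Dq; split=> [i y|i y z yz].
  have le : (#|maj_reads c D r i y| <= \sum_(l < 2 * T) q)%N.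
    rewrite /maj_reads; elim/big_ind2: _ => [|A a B b Aa Bb|l _].
    - by rewrite cards0.
    - by apply: leq_trans (leq_add Aa Bb); rewrite leq_card_setU.
    - exact: leq_trans (card_queried _ _) (Dq _ _ _).
  by rewrite sum_nat_const card_ord in le.
have loc l : run (masked c z) (D i (r l)) = run (masked c y) (D i (r l)) /\
    queried (masked c z) (D i (r l)) = queried (masked c y) (D i (r l)).
  apply: queried_local => p pq; rewrite !tnth_mktuple yz //.
  by apply/bigcupP; exists l.
split; last by apply: eq_bigr => l _; case: (loc l).
rewrite /maj_correct /maj; congr ((_ < _)%N == _).
by apply: eq_card => l; rewrite !inE; case: (loc l) => ->.
Qed.

(* Chernoff's argument with the exponential moment of base 2. *)
Lemma card_half_wrong (R : realType) (X : finType) (wrong : pred X) T :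
  (3 * #|[set x | wrong x]| <= #|X|)%N ->
  #|[set r : {ffun 'I_(2 * T) -> X} | (T <= #|[set l | wrong (r l)]|)%N]|%:R
    <= (8 / 9) ^+ T * #|{ffun 'I_(2 * T) -> X}|%:R :> R.
Proof.
move=> w3.
rewrite -sum1_card natr_sum big_mkcond /=.
(* The indicator is at most 2 to the number of wrong runs minus [T], which factors over the runs. *)
apply: (@le_trans _ _ (\sum_(r : {ffun 'I_(2 * T) -> X})
    (1 / 2) ^+ T * \prod_l (if wrong (r l) then 2 else 1))).
  apply: ler_sum => r _; rewrite inE -big_mkcond /= prodr_const.
  have -> : #|[pred l | wrong (r l)]| = #|[set l | wrong (r l)]|.
    by apply: eq_card => l; rewrite !inE.
  case: leqP => [le|_]; last by rewrite mulr_ge0 ?exprn_ge0 //; lra.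
  rewrite -(subnK le) exprD mulrCA -exprMn (_ : 1 / 2 * 2 = 1); last by lra.
  by rewrite expr1n mulr1 exprn_ege1 // ler1n.
(* Each run contributes at most [4/3 * #|X|], and [(4/3)^2 / 2 = 8/9]. *)
rewrite -mulr_sumr -(bigA_distr_bigA (fun _ x => if wrong x then 2 else 1)) /=.
rewrite prodr_const card_ord card_ffun card_ord natrX !exprM -!exprMn.
apply: lerXn2r; rewrite ?nnegrE.
- by rewrite mulr_ge0 ?exprn_ge0 ?sumr_ge0 // => [|x _]; [lra | case: ifP].
- by rewrite mulr_ge0 ?exprn_ge0 //; lra.
have -> : \sum_(x : X) (if wrong x then 2 else 1) = #|X|%:R + #|[set x | wrong x]|%:R :> R.
  rewrite -[#|X|]sum1_card -[#|[set _ | _]|]sum1_card !natr_sum.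
  rewrite [X in _ + X]big_mkcond -big_split /=; apply: eq_bigr => x _.
  by rewrite inE; case: (wrong x); rewrite ?addr0.
move: w3; rewrite -(ler_nat R) natrM.
have : 0 <= #|X|%:R :> R by [].
have : 0 <= #|[set x | wrong x]|%:R :> R by [].
move: (#|X|%:R : R) (#|[set x | wrong x]|%:R : R) => A B B0 A0 le.
have : (A + B) ^+ 2 <= (4 / 3 * A) ^+ 2.
  by apply: lerXn2r; rewrite ?nnegrE; lra.
by rewrite exprMn; lra.
Qed.

(** Union bound over the [k] bits: a vote errs only if at least [T] of its [2T] runs do, ties
    included, which has probability at most [(8/9)^T]. *)
Lemma maj_amplify (R : realType) n k T lr (w : bits n) (m : bits k)
    (D : 'I_k -> bits lr -> oracle_alg n) (delta : R) :
  delta < 1 / 3 -> 2 * k%:R * (8 / 9) ^+ T <= 1 :> R ->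
  locally_computes (fun i r => run w (D i r)) m delta ->
  1 / 2 * #|{ffun 'I_(2 * T) -> bits lr}|%:R <=
  \sum_(r : {ffun 'I_(2 * T) -> bits lr})
     [forall i, maj (D i) r w == tnth m i]%:R :> R.
Proof.
move=> d3 kT lc; set N : R := #|_|%:R.
pose wrong i x := run w (D i x) != tnth m i.
pose bad i (r : {ffun 'I_(2 * T) -> bits lr}) := (T <= #|[set l | wrong i (r l)]|)%N.
have X0 : 0 < #|{: bits lr}|%:R :> R by rewrite card_tuple card_bool ltr0n expn_gt0.
have w3 i : (3 * #|[set x | wrong i x]| <= #|{: bits lr}|)%N.
  have := forallP lc i; rewrite /Pr ler_pdivlMr // => le.
  have e := cardsC [set x | run w (D i x) == tnth m i].
  have e2 : #|~: [set x | run w (D i x) == tnth m i]| = #|[set x | wrong i x]|.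
    by apply: eq_card => x; rewrite !inE.
  rewrite e2 in e; rewrite -(ler_nat R) natrM.
  have : (1 - 1 / 3) * #|{: bits lr}|%:R <= (1 - delta) * #|{: bits lr}|%:R.
    by rewrite ler_pM2r //; lra.
  by rewrite -e !natrD in le *; lra.
have ok r : 1 - \sum_i (bad i r)%:R <= [forall i, maj (D i) r w == tnth m i]%:R :> R.
  case: (boolP [forall _, _]) => [_|].
    by rewrite lerBlDr lerDl sumr_ge0.
  rewrite negb_forall => /existsP[i ni].
  have bi : bad i r.
    rewrite /bad leqNgt; apply: contra ni => lt.
    have := cardsC [set l | run w (D i (r l))]; rewrite card_ord => e.
    rewrite /maj; move: lt; rewrite /wrong; case: (tnth m i) => lt.
      have -> : (T < #|[set l | run w (D i (r l))]|)%N; last by [].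
      have e2 : #|~: [set l | run w (D i (r l))]| = #|[set l | run w (D i (r l)) != true]|.
        by apply: eq_card => l; rewrite !inE; case: (run _ _).
      by rewrite e2 in e; lia.
    rewrite eqbF_neg -leqNgt; apply: ltnW; apply: leq_trans lt.
    by rewrite ltnS; apply: subset_leq_card; apply/subsetP => l; rewrite !inE => ->.
  rewrite (bigD1 i) //= bi mulr1n mulr0n opprD addNKr oppr_le0.
  exact: sumr_ge0.
apply: le_trans (ler_sum _ (fun r _ => ok r)).
rewrite sumrB sumr_const -/N exchange_big /=.
have : \sum_(i < k) \sum_r (bad i r)%:R <= \sum_(i < k) (8 / 9) ^+ T * N.
  apply: ler_sum => i _; apply: le_trans (card_half_wrong R T (w3 i)).
  rewrite -sum1_card natr_sum [leRHS]big_mkcond /=; apply: ler_sum => r _.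
  by rewrite inE -/(bad i r); case: (bad i r).
rewrite sumr_const card_ord -[X in _ <= X -> _]mulr_natr.
have : 2 * k%:R * (8 / 9) ^+ T * N <= 1 * N by rewrite ler_wpM2r.
lra.
Qed.

(** * Double counting of successful decodings *)

Lemma masked_bij n (c : bits n) : bijective (masked c).
Proof.
exists (fun w : bits n => [ffun i => tnth c i (+) tnth w i]).
  by move=> z; apply/ffunP => i; rewrite ffunE tnth_mktuple addbA addbb.
by move=> w; apply: eq_from_tnth => i; rewrite tnth_mktuple ffunE addbA addbb.
Qed.

(* Under the uniform distribution the word is independent of the message. *)
Lemma sum_uniform_decode (R : realType) n k (Enc : bits k -> bits n)
    (f : 'I_k -> bits n -> bool) :
  \sum_m muPr (0 : R) (conj_fam (fun i z => f i (masked (Enc m) z) == tnth m i)) = 1.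
Proof.
have -> : \sum_m muPr (0 : R) (conj_fam (fun i z => f i (masked (Enc m) z) == tnth m i)) =
    \sum_m \sum_(w : bits n) (1 / 2) ^+ n * [forall i, f i w == tnth m i]%:R.
  apply: eq_bigr => m _; rewrite [RHS](reindex (masked (Enc m))) /=.
    by apply: eq_bigr => z _; rewrite mu0.
  exact/onW_bij/masked_bij.
rewrite exchange_big /= (eq_bigr (fun=> (1 / 2) ^+ n)).
  rewrite sumr_const card_tuple card_bool -[LHS]mulr_natr natrX -exprMn.
  by rewrite (_ : 1 / 2 * 2 = 1) ?expr1n //; lra.
(* For a fixed word, exactly one message is the decoded one. *)
move=> w _; rewrite -mulr_sumr (bigD1 [tuple f i w | i < k]) //= big1.
  have -> : [forall i, f i w == tnth [tuple f i0 w | i0 < k] i].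
    by apply/forallP => i; rewrite tnth_mktuple.
  by rewrite addr0 mulr1.
move=> m; case: forallP => // H /eqP[]; apply: eq_from_tnth => i.
by rewrite tnth_mktuple; apply/esym/eqP.
Qed.

Lemma hdist_masked (R : realType) n (c : bits n) (z : cube n) :
  hdist R c (masked c z) = #|[set i | z i]|%:R / n%:R.
Proof.
rewrite /hdist; congr (_%:R / _); apply: eq_card => i.
by rewrite !inE tnth_mktuple; case: (tnth c i); case: (z i).
Qed.

(** If the inequality failed, the total success [U] would be at most 3/16 of [NS * NR * M] by the
    coin problem, and at least 1/4 of it by correctness of the decoder. *)
Lemma decoder_query_tradeoff (R : realType) k n (Enc : bits k -> bits n) L q
    (epsilon delta : R) ls lr
    (Dec : 'I_k -> 'I_L -> bits ls -> bits lr -> oracle_alg n) T t :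
  (0 < n)%N -> (0 < t)%N -> 16 * L%:R <= 2 ^+ k :> R -> 16 * L%:R <= 2 ^+ t :> R ->
  2 * k%:R * (8 / 9) ^+ T <= 1 :> R ->
  0 < epsilon < 1 / 4 -> 4 <= epsilon ^+ 2 * n%:R -> delta < 1 / 3 ->
  local_list_decoder Enc (1 / 2 - epsilon) q delta Dec ->
  1 < 336 * (2 * T * q)%:R * t%:R * epsilon.
Proof.
move=> n0 t0 Lk Lt kT /andP[e0 e4] e2n d3 [Dq Dok]; rewrite ltNge; apply/negP => small.
pose th := 3 / 2 * epsilon.
have hth : 0 < th <= 3 / 8 by rewrite /th; apply/andP; split; lra.
have hth2 : 0 <= th <= 1 / 2 by rewrite /th; apply/andP; split; lra.
pose rT := {ffun 'I_(2 * T) -> bits lr}.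
pose G rs (r : rT) j m := conj_fam (maj_correct (Enc m) m (fun i => Dec i j rs) r).
(* With [th = 3/2 * epsilon], the condition [112 Q t th <= 1/2] reads [336 Q t epsilon <= 1]. *)
have coin rs r j m : muPr th (G rs r j m) <= 2 * muPr 0 (G rs r j m) + (1 / 2) ^+ t.
  apply: (coin_problem (maj_correct_reads _ _ _ _) t0 hth) => //.
  by move: small; rewrite /th; lra.
set NS : R := #|{: bits ls}|%:R; set NR : R := #|{: rT}|%:R; set M : R := 2 ^+ k.
have NS0 : 0 < NS by rewrite /NS card_tuple card_bool ltr0n expn_gt0.
have NR0 : 0 < NR.
  by rewrite /NR card_ffun card_tuple card_bool ltr0n !expn_gt0.
have M0 : 0 < M by rewrite exprn_gt0.
pose U := \sum_rs \sum_(r : rT) \sum_j \sum_m muPr th (G rs r j m).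
have upper : U <= 3 / 16 * (NS * NR * M).
  apply: (@le_trans _ _ (\sum_(rs : bits ls) \sum_(r : rT) 3 / 16 * M)); last first.
    rewrite !sumr_const -[leLHS]mulr_natr -[X in X * _]mulr_natr -/NS -/NR; lra.
  apply: ler_sum => rs _; apply: ler_sum => r _.
  (* For each [j] the uniform probabilities sum to 1 over [m] and are doubled; the error [(1/2)^t]
     is paid once per message. *)
  apply: (@le_trans _ _ (\sum_(j < L) (2 + M * (1 / 2) ^+ t))).
    apply: ler_sum => j _; apply: le_trans (ler_sum _ (fun m _ => coin rs r j m)) _.
    rewrite big_split /= -mulr_sumr.
    rewrite (sum_uniform_decode R Enc (fun i => maj (fun x => Dec i j rs x) r)).
    rewrite mulr1 lerD2l.
    by rewrite sumr_const card_tuple card_bool -[leLHS]mulr_natl natrX.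
  rewrite sumr_const card_ord -[leLHS]mulr_natl mulrDr mulrCA.
  have h2 : 2 ^+ t * (1 / 2) ^+ t = 1 :> R.
    by rewrite -exprMn (_ : 2 * (1 / 2) = 1) ?expr1n //; lra.
  have : 16 * L%:R * (1 / 2) ^+ t <= 2 ^+ t * (1 / 2) ^+ t :> R.
    by rewrite ler_wpM2r ?exprn_ge0 //; lra.
  rewrite h2 => le; have : M * (16 * L%:R * (1 / 2) ^+ t) <= M * 1.
    by apply: ler_wpM2l le; apply: ltW.
  rewrite -/M in Lk; lra.
(* Since [th - epsilon / 2 = epsilon], noise that is not heavy leaves the word within distance
   [1/2 - epsilon]. *)
pose heavy (z : cube n) := (1 / 2 - th + epsilon / 2) * n%:R < #|[set i | z i]|%:R.
have n0R : 0 < n%:R :> R by rewrite ltr0n.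
(* Two thirds of the shared strings admit a good [j], which then succeeds for half of the [r]. This
   [j] may depend on [rs], [m] and [z]; the sum over [j] absorbs the choice. *)
have inner m z : ~~ heavy z -> NS * NR / 3 <=
    \sum_rs \sum_(r : rT) \sum_j (G rs r j m z)%:R.
  rewrite /heavy -leNgt => light.
  have ml : m \in ListDec Enc (1 / 2 - epsilon) (masked (Enc m) z).
    rewrite inE hdist_masked ler_pdivrMr //.
    by rewrite (_ : 1 / 2 - epsilon = 1 / 2 - th + epsilon / 2) // /th; lra.
  have := Dok _ _ ml; rewrite /Pr ler_pdivlMr // -/NS; set P := [set _ | _] => leP.
  apply: (@le_trans _ _ (\sum_(rs in P) 1 / 2 * NR)).
    rewrite sumr_const -[leRHS]mulr_natl.
    have : 2 / 3 * NS * (1 / 2 * NR) <= #|P|%:R * (1 / 2 * NR).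
      by rewrite ler_wpM2r // mulr_ge0 ?ltW //; lra.
    lra.
  rewrite big_mkcond /=; apply: ler_sum => rs _.
  case: ifP => [|_]; last by apply: sumr_ge0 => r _; apply: sumr_ge0.
  rewrite inE => /existsP[j lc].
  apply: le_trans (maj_amplify d3 kT lc) _.
  apply: ler_sum => r _; rewrite (bigD1 j) //= lerDl.
  exact: sumr_ge0.
have lower : 1 / 4 * (NS * NR * M) <= U.
  have -> : U = \sum_m \sum_z mu th z * \sum_rs \sum_(r : rT) \sum_j (G rs r j m z)%:R.
    rewrite /U /muPr; under eq_bigr do under eq_bigr do rewrite exchange_big /=.
    under eq_bigr do rewrite exchange_big /=; rewrite exchange_big /=.
    apply: eq_bigr => m _.
    under eq_bigr do under eq_bigr do rewrite exchange_big /=.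
    under eq_bigr do rewrite exchange_big /=; rewrite exchange_big /=.
    apply: eq_bigr => z _; rewrite mulr_sumr; apply: eq_bigr => rs _.
    by rewrite mulr_sumr; apply: eq_bigr => r _; rewrite mulr_sumr.
  apply: (@le_trans _ _ (\sum_(m : bits k) 1 / 4 * (NS * NR))).
    by rewrite sumr_const card_tuple card_bool -[leRHS]mulr_natr natrX -/M; lra.
  apply: ler_sum => m _.
  have ep : 0 < epsilon / 2 by lra.
  have cheb := mu_chebyshev hth2 ep n0; rewrite -/heavy in cheb.
  (* Heavy noise has probability at most 1/4, so at least [3/4 * 1/3 = 1/4] survives. *)
  have c4 : (4 * (epsilon / 2) ^+ 2 * n%:R)^-1 <= 1 / 4.
    rewrite div1r lef_pV2 ?posrE //; last by rewrite mulr_gt0 // mulr_gt0 // exprn_gt0.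
    by rewrite exprMn; lra.
  have NN : 0 < NS * NR by rewrite mulr_gt0.
  apply: (@le_trans _ _ (\sum_z mu th z * ((1 - (heavy z)%:R) * (NS * NR / 3)))); last first.
    apply: ler_sum => z _; rewrite ler_wpM2l ?mu_ge0 //.
    have [_|hz] := boolP (heavy z); last by rewrite subr0 mul1r inner.
    by rewrite subrr mul0r; apply: sumr_ge0 => rs _; apply: sumr_ge0 => r _; apply: sumr_ge0.
  under eq_bigr do rewrite mulrA mulrBr mulr1.
  rewrite -mulr_suml sumrB sum_mu -/(muPr th heavy).
  have : 3 / 4 * (NS * NR / 3) <= (1 - muPr th heavy) * (NS * NR / 3).
    by rewrite ler_wpM2r //; lra.
  lra.
have : 0 < NS * NR * M by rewrite !mulr_gt0.
lra.
Qed.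

(** * Logarithms and choice of parameters *)

Lemma log2_ge0 (R : realType) m : 0 <= log2 (m%:R : R).
Proof.
rewrite /log2; apply: divr_ge0; last by rewrite ln_ge0 // ler1n.
by case: m => [|m]; [rewrite ln0 | rewrite ln_ge0 // ler1n].
Qed.

Lemma up_log_le_log2 (R : realType) m : (up_log 2 m)%:R <= 1 + log2 (m%:R : R).
Proof.
have [m1|m1] := leqP m 1.
  have -> : up_log 2 m = 0%N by apply/eqP; rewrite up_log_eq0 m1 orbT.
  by have := log2_ge0 R m; lra.
have l2 : 0 < ln (2 : R) by rewrite ln_gt0 // ltr1n.
have u0 : (0 < up_log 2 m)%N by rewrite up_log_gt0.
have lt := up_log_gtn (isT : (1 < 2)%N) m1.
have : ln ((2 : R) ^+ (up_log 2 m).-1) <= ln m%:R.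
  by rewrite ler_ln ?posrE ?exprn_gt0 ?ltr0n -?natrX ?ler_nat; lia.
rewrite lnXn // -[X in X <= _ -> _]mulr_natl -ler_pdivlMr // -/(log2 m%:R) => h.
by rewrite -(prednK u0) -natr1; lra.
Qed.

Theorem theorem1p6 (R : realType) :
  exists beta a c : R,
    [/\ 0 < beta, 1 < a, 1 < c &
     forall (k n : nat) (Enc : bits k -> bits n) (L q : nat)
       (epsilon delta : R) (ls lr : nat)
       (Dec : 'I_k -> 'I_L -> bits ls -> bits lr -> oracle_alg n),
       (0 < k)%N -> (0 < n)%N ->
       L%:R <= beta * 2 ^+ k ->
       a / Num.sqrt n%:R < epsilon -> epsilon < 1 / 4 ->
       delta < 1 / 3 ->
       local_list_decoder Enc (1 / 2 - epsilon) q delta Dec ->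
       q%:R >= 1 / (c * Num.sqrt epsilon * log2 k%:R) - log2 L%:R].
Proof.
(* [beta] gives [16 L <= 2^k], [a] gives [epsilon^2 n >= 4], and [246^2 = 60516] exceeds
   [336 * 2 * 18 * 5 = 60480]. *)
exists (1 / 16), 2, 246; split; [lra|lra|lra|].
move=> k n Enc L q e delta ls lr Dec k0 n0 Lk ae e4 d3 decoder.
have lL := log2_ge0 R L.
(* For [k = 1] the logarithm is 0 and so is its inverse by convention; the bound becomes
   [- log2 L <= q]. *)
have [k1|k1] := leqP k 1.
  have -> : k = 1%N by lia.
  rewrite /log2 ln1 mul0r mulr0 invr0 mulr0 sub0r -/(log2 L%:R).
  by apply: le_trans (ler0n R q); rewrite oppr_le0.
have n0R : 0 < n%:R :> R by rewrite ltr0n.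
have sn : 0 < Num.sqrt n%:R :> R by rewrite sqrtr_gt0.
have e0 : 0 < e by apply: lt_trans ae; rewrite divr_gt0.
have e2n : 4 <= e ^+ 2 * n%:R.
  move: ae; rewrite ltr_pdivrMr // => ae.
  rewrite -(sqr_sqrtr (ltW n0R)) -exprMn (_ : 4 = 2 ^+ 2); last by ring.
  by apply: lerXn2r; rewrite ?nnegrE //; [rewrite mulr_ge0 // ltW | exact: ltW].
have le2up m : m%:R <= 2 ^+ up_log 2 m :> R by rewrite -natrX ler_nat up_logP.
(* The 4 yields the factor 16 in [16 L <= 2^t]; the 6 is there because [(8/9)^6 <= 1/2]. *)
pose t := (up_log 2 L + 4)%N; pose T := (6 * (1 + up_log 2 k))%N.
have Lt : 16 * L%:R <= 2 ^+ t :> R.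
  by have := le2up L; rewrite /t exprD; lra.
have kT : 2 * k%:R * (8 / 9) ^+ T <= 1 :> R.
  have h : (8 / 9) ^+ T <= (1 / 2) ^+ (1 + up_log 2 k) :> R.
    by rewrite /T exprM lerXn2r ?nnegrE //; lra.
  have p2 : 0 < 2 ^+ (1 + up_log 2 k) :> R by rewrite exprn_gt0.
  have : 2 * k%:R <= 2 ^+ (1 + up_log 2 k) :> R.
    by have := le2up k; rewrite exprD; lra.
  have z0 : 0 <= (8 / 9) ^+ T :> R by rewrite exprn_ge0 //; lra.
  move=> /(ler_wpM2r z0) /le_trans; apply.
  apply: le_trans (ler_wpM2l (ltW p2) h) _.
  by rewrite -exprMn (_ : 2 * (1 / 2) = 1) ?expr1n //; lra.
have Lk16 : 16 * L%:R <= 2 ^+ k :> R by lra.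
have t0 : (0 < t)%N by rewrite /t addn4.
have ee : 0 < e < 1 / 4 by rewrite e0.
have := decoder_query_tradeoff n0 t0 Lk16 Lt kT ee e2n d3 decoder.
set l := log2 L%:R in lL *; set K := log2 k%:R.
have K1 : 1 <= K.
  have l2 : 0 < ln (2 : R) by rewrite ln_gt0 // ltr1n.
  rewrite /K /log2 ler_pdivlMr // mul1r ler_ln ?posrE ?ltr0n // ler_nat //.
have tb : t%:R <= 5 * (1 + l) by have := up_log_le_log2 R L; rewrite /t natrD -/l; lra.
have Tb : T%:R <= 18 * K.
  by have := up_log_le_log2 R k; rewrite /T natrM natrD -/K; lra.
have [->|q0] := posnP q; first by rewrite muln0 mulr0 !mul0r ltr10.
have q1 : 1 <= q%:R :> R by rewrite ler1n.
rewrite 2!natrM => big.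
(* The tradeoff bounds [e T t q] from below. As [K >= 1] and [q >= 1], one has [K <= K^2] and
   [q (1 + l) <= (q + l)^2], so the product is dominated by a multiple of [y^2]; a square root then
   gives the claim. *)
set y := Num.sqrt e * K * (q%:R + l).
have K0 : 0 < K by lra.
have y0 : 0 <= y.
  by rewrite mulr_ge0 ?addr_ge0 // mulr_ge0 ?sqrtr_ge0 // ltW.
have yy : y ^+ 2 = e * (K ^+ 2 * (q%:R + l) ^+ 2).
  by rewrite /y !exprMn (sqr_sqrtr (ltW e0)) -mulrA.
have T0 : 0 <= T%:R :> R by [].
have tt0 : 0 <= t%:R :> R by [].
have y1 : 1 < (246 * y) ^+ 2.
  apply: (lt_le_trans big); rewrite exprMn yy.
  have KK : K <= K ^+ 2 by rewrite expr2 ler_peMl //; lra.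
  have qq : q%:R * (1 + l) <= (q%:R + l) ^+ 2 by nra.
  have s1 : T%:R * t%:R <= 18 * K * (5 * (1 + l)) by apply: ler_pM.
  have s2 : T%:R * t%:R * q%:R <= 18 * K * (5 * (1 + l)) * q%:R.
    by rewrite ler_wpM2r.
  have s3 : K * (q%:R * (1 + l)) <= K ^+ 2 * (q%:R + l) ^+ 2.
    by apply: ler_pM => //; [exact: ltW | rewrite mulr_ge0 // addr_ge0].
  have : e * (T%:R * t%:R * q%:R) <= e * (90 * (K ^+ 2 * (q%:R + l) ^+ 2)).
    by apply: ler_wpM2l; [exact: ltW | lra].
  have : 0 <= e * (K ^+ 2 * (q%:R + l) ^+ 2) by rewrite -yy sqr_ge0.
  lra.
rewrite lerBlDr.
have d0 : 0 < 246 * Num.sqrt e * K.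
  by rewrite mulr_gt0 // mulr_gt0 // sqrtr_gt0.
rewrite ler_pdivrMr // (_ : _ * _ = 246 * y); last by rewrite /y; ring.
rewrite leNgt; apply/negP => lt1.
have : (246 * y) ^+ 2 <= 1.
  by apply: exprn_ile1; [exact: mulr_ge0 | exact: ltW].
by rewrite leNgt y1.
Qed.
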